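(* Let $\mathcal{T}\in\mathbb{R}^{n_1\times\cdots\times n_d}$ be a $d$th-order tensor whose TR representation is $\mathcal{T}=\Re(\mathcal{Z}_1,\ldots,\mathcal{Z}_d)$ and let $\mathbf{u}_k\in\mathbb{R}^{n_k}$, $k=1,\ldots,d$, be a set of vectors. Then the multilinear product $c=\mathcal{T}\times_1\mathbf{u}_1^T\times_2\cdots\times_d\mathbf{u}_d^T$ can be computed by the multilinear product on each core, namely $$c=\Re(\mathbf{X}_1,\ldots,\mathbf{X}_d),\qquad\text{where}\quad \mathbf{X}_k=\sum_{i_k=1}^{n_k}\mathbf{Z}_k(i_k)\,u_k(i_k),\quad k=1,\ldots,d.$$
   Context: Tensor ring (TR) decomposition: given cores $\mathcal{Z}_k\in\mathbb{R}^{r_k\times n_k\times r_{k+1}}$, $k=1,\ldots,d$, with $r_{d+1}=r_1$, the notation $\mathcal{T}=\Re(\mathcal{Z}_1,\ldots,\mathcal{Z}_d)$ means that $\mathcal{T}\in\mathbb{R}^{n_1\times\cdots\times n_d}$ and $$T(i_1,\ldots,i_d)=\mathrm{Tr}\{\mathbf{Z}_1(i_1)\mathbf{Z}_2(i_2)\cdots\mathbf{Z}_d(i_d)\}\quad\text{for all } 1\le i_k\le n_k,$$ where $\mathbf{Z}_k(i_k)\in\mathbb{R}^{r_k\times r_{k+1}}$ is the $i_k$th lateral slice of $\mathcal{Z}_k$, i.e. the matrix with entries $\mathcal{Z}_k(\alpha,i_k,\beta)$. When the cores are matrices $\mathbf{X}_k\in\mathbb{R}^{r_k\times r_{k+1}}$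 (no free index), $\Re(\mathbf{X}_1,\ldots,\mathbf{X}_d)$ is the scalar $\mathrm{Tr}(\mathbf{X}_1\mathbf{X}_2\cdots\mathbf{X}_d)$. Multilinear product of a tensor with vectors: $\mathcal{T}\times_1\mathbf{u}_1^T\times_2\cdots\times_d\mathbf{u}_d^T=\sum_{i_1,\ldots,i_d}T(i_1,\ldots,i_d)\,u_1(i_1)\cdots u_d(i_d)$, where $u_k(i_k)$ is the $i_k$th entry of $\mathbf{u}_k$. *)

(* Defs.v *)
From HB Require Import structures.
From mathcomp Require Import all_boot all_order all_algebra.
From mathcomp Require Import reals.

Set Implicit Arguments.
Unset Strict Implicit.
Unset Printing Implicit Defensive.

Import GRing.Theory.
Local Open Scope ring_scope.

Definition multi_index (d : nat) (n : 'I_d -> nat) : finType :=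
  {dffun forall k : 'I_d, 'I_(n k)}.

Definition tensor (R : Type) (d : nat) (n : 'I_d -> nat) : Type :=
  {ffun multi_index n -> R}.

(* Ranks are a sequence [r : nat -> nat], of which only [r 0], ..., [r d] matter.
   With 0-based indices, core [k < d] has size r k x n k x r k.+1, and the ring
   is closed by the equation [r d = r 0]. *)
Definition core (R : Type) (p m q : nat) : Type := 'I_p -> 'I_m -> 'I_q -> R.

Definition core_slice (R : Type) (p m q : nat) (Z : core R p m q) (i : 'I_m) :
    'M[R]_(p, q) :=
  \matrix_(a, b) Z a i b.

Fixpoint chain_mul (R : pzSemiRingType) (d : nat) : forall r : nat -> nat,
    (forall k : 'I_d, 'M[R]_(r k, r k.+1)) -> 'M[R]_(r 0%N, r d) :=
  match d with
  | 0 => fun r _ => 1%:M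
  | d'.+1 => fun r X =>
      X ord0 *m chain_mul (r := fun k => r k.+1) (fun k => X (lift ord0 k))
  end.

(* The cast only identifies the types 'M_(r 0, r d) and 'M_(r 0, r 0). *)
Definition ring_trace (R : pzSemiRingType) (d : nat) (r : nat -> nat)
    (hr : r d = r 0%N) (X : forall k : 'I_d, 'M[R]_(r k, r k.+1)) : R :=
  \tr (castmx (erefl (r 0%N), hr) (chain_mul X)).

Definition ring_tensor (R : pzSemiRingType) (d : nat) (n : 'I_d -> nat)
    (r : nat -> nat) (hr : r d = r 0%N)
    (Z : forall k : 'I_d, core R (r k) (n k) (r k.+1)) : tensor R n :=
  [ffun i : multi_index n => ring_trace hr (fun k => core_slice (Z k) (i k))].

Definition multilinear_prod (R : pzSemiRingType) (d : nat) (n : 'I_d -> nat)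
    (T : tensor R n) (u : forall k : 'I_d, 'cV[R]_(n k)) : R :=
  \sum_(i : multi_index n) T i * \prod_(k < d) u k (i k) 0.

(* Main.v *)
Require Import Defs.
From mathcomp Require Import all_boot all_order all_algebra.
From mathcomp Require Import reals.
Import GRing.Theory.
Local Open Scope ring_scope.

(** The chain product [X_1 X_2 ... X_d] is multilinear in its factors, and the
    trace is linear. Expanding each [X_k] as the combination of the slices of
    the k-th core with weights [u_k] therefore turns the trace of the chain
    into a sum over all multi-indices of the trace of a chain of slices, which
    is an entry of the tensor, times the product of the chosen weights; this
    sum is the multilinear product.

    Multilinearity is split into its two halves, both proved by induction on
    the length of the chain: [chain_mul_sum] distributes the chain over sums,
    and [chain_mul_scale] pulls scalars out. The inductive step of the former
    views a multi-index as its first entry paired with the remaining ones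
    ([split_index_bij]). *)

Definition split_index {d : nat} {n : 'I_d.+1 -> nat} (i : multi_index n) :
    'I_(n ord0) * multi_index (fun k : 'I_d => n (lift ord0 k)) :=
  (i ord0, [ffun k => i (lift ord0 k)]).

(** Injectivity and a cardinality count suffice here; an explicit inverse would
    have to build a dependent function by cases on whether its argument is 0. *)
Lemma split_index_bij (d : nat) (n : 'I_d.+1 -> nat) :
  bijective (@split_index d n).
Proof.
apply: inj_card_bij => [i j [eq0 /ffunP eqS]|].
  apply/ffunP => k; case: (unliftP ord0 k) => [k'|] -> //.
  by have := eqS k'; rewrite !ffunE.
by rewrite card_prod !card_dep_ffun !foldrE !big_image /= big_ord_recl.
Qed.

Lemma eq_chain_mul {R : pzSemiRingType} {d : nat} {r : nat -> nat}
    (X Y : forall k : 'I_d, 'M[R]_(r k, r k.+1)) :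
  (forall k, X k = Y k) -> chain_mul X = chain_mul Y.
Proof.
elim: d r X Y => [//|d IHd] r X Y eqXY /=.
rewrite eqXY; congr (_ *m _); apply: (IHd (fun k => r k.+1)) => k.
exact: (eqXY (lift ord0 k)).
Qed.

Lemma chain_mul_sum (R : pzSemiRingType) (d : nat) (n : 'I_d -> nat)
    (r : nat -> nat) (A : forall k : 'I_d, 'I_(n k) -> 'M[R]_(r k, r k.+1)) :
  chain_mul (fun k => \sum_(i < n k) A k i) =
  \sum_(i : multi_index n) chain_mul (fun k => A k (i k)).
Proof.
elim: d n r A => [|d IHd] n r A.
  (* There is exactly one empty multi-index, hence exactly one summand. *)
  rewrite /= big_const card_dep_ffun foldrE big_map big_enum big_ord0 /=.
  by rewrite addr0.
rewrite /= (IHd _ (fun k => r k.+1)) mulmx_suml.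
under [LHS]eq_bigr => i _ do rewrite mulmx_sumr.
rewrite pair_bigA (reindex _ (onW_bij _ (split_index_bij _ n))).
apply: eq_bigr => i _ /=; congr (_ *m _).
by apply: eq_chain_mul => k; rewrite ffunE.
Qed.

Lemma chain_mul_scale (R : comPzSemiRingType) (d : nat) (r : nat -> nat)
    (c : 'I_d -> R) (X : forall k : 'I_d, 'M[R]_(r k, r k.+1)) :
  chain_mul (fun k => c k *: X k) = (\prod_k c k) *: chain_mul X.
Proof.
elim: d r c X => [|d IHd] r c X /=; first by rewrite big_ord0 scale1r.
rewrite (IHd (fun k => r k.+1) (fun k => c (lift ord0 k))) big_ord_recl.
by rewrite -scalemxAl -scalemxAr scalerA.
Qed.

Theorem theorem4 (R : realType) (d : nat) (n : 'I_d -> nat)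
    (r : nat -> nat) (hr : r d = r 0%N)
    (Z : forall k : 'I_d, core R (r k) (n k) (r k.+1))
    (T : tensor R n) (hT : T = ring_tensor hr Z)
    (u : forall k : 'I_d, 'cV[R]_(n k)) :
  multilinear_prod T u =
  ring_trace hr (fun k : 'I_d => \sum_(i < n k) u k i 0 *: core_slice (Z k) i).
Proof.
rewrite hT /multilinear_prod /ring_trace chain_mul_sum /mxtrace.
(* Working entrywise makes the cast a mere relabelling of column indices. *)
under [RHS]eq_bigr => a _ do rewrite castmxE summxE.
rewrite exchange_big; apply: eq_bigr => i _ /=.
rewrite ffunE mulrC mulr_sumr; apply: eq_bigr => a _.
by rewrite chain_mul_scale mxE castmxE.
Qed.
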